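(* Let $F$ be a field, let $D$ be a central division algebra over $F$, let $n$ be a positive integer, and let $\phi(z)=z^n+c_{n-1}z^{n-1}+\dots+c_0$ be a standard polynomial with $c_0,\dots,c_{n-1}\in D$. Let $C_\phi\in M_n(D)$ be its companion matrix. Then the roots of $\phi(z)$ in $D$ are exactly the left eigenvalues of $C_\phi$. Furthermore, for every left eigenvalue $\lambda$ of $C_\phi$, the column vector $v=(1,\lambda,\dots,\lambda^{n-1})^{T}\in D^n$ is a corresponding left eigenvector, i.e. $C_\phi v=\lambda v$.
   Context: A central division algebra $D$ over $F$ is a division algebra with center $F$ and of finite dimension over $F$. A standard polynomial over $D$ is a monic polynomial whose coefficients appear on the left of the variable; a root is an element $\lambda\in D$ with $\phi(\lambda)=\lambda^n+c_{n-1}\lambda^{n-1}+\dots+c_1\lambda+c_0=0$. The companion matrix of $\phi$ is $$C_\phi=\begin{pmatrix}0&1&0&\dots&0\\0&0&1&&0\\ \vdots&&&\ddots&\\0&0&\dots&0&1\\-c_0&-c_1&\dots&-c_{n-2}&-c_{n-1}\end{pmatrix}\in M_n(D).$$ A left eigenvalue of a matrix $A\in M_n(D)$ is an element $\lambda\in D$ for which there is a nonzero column vector $v\in D^n$ with $Av=\lambda v$ (entrywise left multiplication by $\lambda$). *)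

(* Defs.v *)
From mathcomp Require Import all_boot all_order all_algebra all_field.

Set Implicit Arguments.
Unset Strict Implicit.
Unset Printing Implicit Defensive.

Import GRing.Theory.

Local Open Scope ring_scope.

(* Finite dimensionality over F is part of the falgType structure, and so is
   0 <> 1.  The space 1%VS is the line F * 1. *)
Definition central_division_algebra (F : fieldType) (D : falgType F) : Prop :=
  (forall x : D, x != 0 -> x \is a GRing.unit) /\ 'Z({:D})%VS = 1%VS.

(* In the lmodType D structure of 'cV[D]_n, lambda *: v multiplies each entry
   of v by lambda on the left. *)
Definition left_eigenvector (D : nzRingType) (n : nat)
    (A : 'M[D]_n) (lambda : D) (v : 'cV[D]_n) : Prop :=
  v != 0 /\ A *m v = lambda *: v.

Definition left_eigenvalue (D : nzRingType) (n : nat)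
    (A : 'M[D]_n) (lambda : D) : Prop :=
  exists v : 'cV[D]_n, left_eigenvector A lambda v.

(* Main.v *)
Require Import Defs.
From mathcomp Require Import all_boot all_order all_algebra all_field.

(** The rows of C_phi v = lambda v other than the last one say
    v_(i+1) = lambda v_i, that is v_i = lambda^i v_0; the last row then says
    phi(lambda) v_0 = 0.  Such a v is nonzero iff v_0 is, and then v_0 is
    invertible. *)

Import GRing.Theory.

Local Open Scope ring_scope.

(** The column comes from a function on [nat], so that the entry [w i.+1] can be named without a
    proof that [i.+1] is in range. *)
Lemma companionmx_mul_col {R : nzRingType} (p : seq R) (w : nat -> R)
    (i : 'I_(size p).-1) :
  (companionmx p *m \col_(j < (size p).-1) w j) i 0 =
    if i == (size p).-2 :> nat then - \sum_(j < (size p).-1) p`_j * w j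
    else w i.+1.
Proof.
rewrite mxE; case: ifP => [i_last | /negbT i_small].
  by rewrite -sumrN; apply: eq_bigr => j _; rewrite !mxE i_last mulNr.
have lt_i1 : (i.+1 < (size p).-1)%N.
  have lt_i := ltn_ord i.
  by rewrite ltn_neqAle lt_i andbT; apply: contra i_small => /eqP/(congr1 predn)/eqP.
(* The only nonzero entry of such a row is the 1 in column [i.+1]. *)
rewrite (bigD1 (Ordinal lt_i1)) //= !mxE (negPf i_small) eqxx mul1r.
rewrite big1 ?addr0 // => j; rewrite -val_eqE /= => /negPf ne_j.
by rewrite !mxE (negPf i_small) eq_sym ne_j mul0r.
Qed.

(** Coefficients stand to the left of the powers of [x], so a right factor [a] passes through the
    sum without commutativity. *)
Lemma horner_monic_mul {R : nzRingType} (p : {poly R}) (x a : R) :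
  p \is monic ->
  p.[x] * a =
    \sum_(j < (size p).-1) p`_j * (x ^+ j * a) + x ^+ (size p).-1 * a.
Proof.
move=> p_monic; rewrite (horner_coef_wide _ (leqSpred (size p))).
rewrite big_ord_recr /= -[p`_(size p).-1]/(lead_coef p) (monicP p_monic) mul1r.
rewrite mulrDl mulr_suml; congr (_ + _); apply: eq_bigr => j _.
by rewrite mulrA.
Qed.

(** The right factor [a] lets one statement serve both directions: [a = 1] turns a root into an
    eigenvector, and the first entry of an arbitrary eigenvector turns an eigenvalue into a root. *)
Lemma companionmx_mul_powers {R : nzRingType} (p : {poly R}) (x a : R) :
  p \is monic -> (0 < (size p).-1)%N ->
  let v := \col_(i < (size p).-1) (x ^+ i * a) in
  companionmx p *m v = x *: v <-> p.[x] * a = 0.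
Proof.
move=> p_monic d_gt0 v; rewrite horner_monic_mul //.
pose w k := x ^+ k * a.
split=> [Cv | pxa0].
  have lt_last : ((size p).-2 < (size p).-1)%N by rewrite prednK.
  have /matrixP/(_ (Ordinal lt_last) 0) := Cv.
  rewrite (companionmx_mul_col _ w) /= eqxx !mxE /= mulrA -exprS prednK // => <-.
  by rewrite subrr.
apply/matrixP => i j; rewrite (ord1 j) (companionmx_mul_col _ w) !mxE mulrA -exprS.
case: eqP => [-> | //]; rewrite prednK //.
by apply/eqP; rewrite eq_sym -addr_eq0 addrC pxa0.
Qed.

Lemma left_eigenvector_companionmx_powers {R : nzRingType} (p : {poly R})
    (x : R) (v : 'cV[R]_(size p).-1) (d_gt0 : (0 < (size p).-1)%N) :
  companionmx p *m v = x *: v ->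
  v = \col_(i < (size p).-1) (x ^+ i * v (Ordinal d_gt0) 0).
Proof.
(* [w] extends [v] by 0 to all of [nat]; this default is never read, since only indices in range
   occur below. *)
move=> Cv; pose w k := if insub k is Some i then v i 0 else 0.
have wE (i : 'I_(size p).-1) : w i = v i 0 by rewrite /w valK.
have v_w : v = \col_i w i by apply/matrixP => i j; rewrite (ord1 j) mxE wE.
apply/matrixP => -[i lt_i] j; rewrite (ord1 j) mxE /=.
elim: i lt_i => [|i IHi] lt_i1.
  by rewrite mul1r; congr (v _ _); apply: val_inj.
have lt_i := ltnW lt_i1.
(* As [i.+1] is still in range, row [i] is not the last one, and it gives entry [i.+1] as [x] times
   entry [i]. *)
have /matrixP/(_ (Ordinal lt_i) 0) := Cv.
rewrite {1}v_w (companionmx_mul_col _ w) mxE /= IHi mulrA -exprS ifN => [<- |].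
  by rewrite -wE.
by rewrite neq_ltn -ltnS prednK // lt_i1.
Qed.

Theorem theorem3p1 (F : fieldType) (D : falgType F)
    (hD : central_division_algebra D)
    (n : nat) (hn : (0 < n)%N)
    (phi : {poly D}) (phi_monic : phi \is monic) (phi_deg : size phi = n.+1) :
  (forall lambda : D,
     root phi lambda <-> left_eigenvalue (companionmx phi) lambda) /\
  (forall lambda : D,
     left_eigenvalue (companionmx phi) lambda ->
     left_eigenvector (companionmx phi) lambda
       (\col_(i < (size phi).-1) lambda ^+ i)).
Proof.
have d_gt0 : (0 < (size phi).-1)%N by rewrite phi_deg.
have root_eigen lambda : root phi lambda ->
    left_eigenvector (companionmx phi) lambda
      (\col_(i < (size phi).-1) lambda ^+ i).
  move=> /rootP phi0; split.
    apply/eqP => /matrixP/(_ (Ordinal d_gt0) 0); rewrite !mxE /= expr0.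
    exact/eqP/oner_neq0.
  have -> : \col_(i < (size phi).-1) lambda ^+ i =
            \col_(i < (size phi).-1) (lambda ^+ i * 1).
    by apply/matrixP => i j; rewrite !mxE mulr1.
  by apply/companionmx_mul_powers; rewrite ?phi0 ?mul0r.
have eigen_root lambda : left_eigenvalue (companionmx phi) lambda ->
    root phi lambda.
  case=> v [v_neq0 Cv].
  have v_powers := left_eigenvector_companionmx_powers _ _ _ d_gt0 Cv.
  set a := v _ 0 in v_powers.
  have a_unit : a \is a GRing.unit.
    apply: hD.1; apply: contra v_neq0 => /eqP a0; apply/eqP.
    by rewrite v_powers a0; apply/matrixP => i j; rewrite !mxE mulr0.
  (* In the last row [a] stands to the right of [phi.[lambda]], so it is cancelled on that side. *)
  apply/rootP/(mulIr a_unit); rewrite mul0r.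
  by apply/companionmx_mul_powers; rewrite -?v_powers.
(* The given eigenvector is not rescaled: the eigenvalue is a root, and the root yields the vector
   of powers. *)
split=> lambda; last by move/eigen_root/root_eigen.
by split=> [/root_eigen|/eigen_root //]; exists (\col_i lambda ^+ i).
Qed.
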